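(* Let $n\ge 0$, $r\ge 2$ and $t$ be integers with $0<t<r/2$. Then $$\mathrm{pd}_{\pm t,r}(n)=p_{\overline{\pm 2t},2r}(n).$$
   Context: A partition of $n$ is a non-increasing sequence of positive integers (its parts) summing to $n$. $\mathrm{pd}_{\pm t,r}(n)$ denotes the number of partitions of $n$ in which parts congruent to $t$ or $-t$ modulo $r$ are distinct (each integer congruent to $\pm t$ modulo $r$ occurs as a part at most once), while all other parts are unrestricted. $p_{\overline{\pm 2t},2r}(n)$ denotes the number of partitions of $n$ with no part congruent to $2t$ or $-2t$ modulo $2r$. *)

(* Defs.v *)
From HB Require Import structures.
From mathcomp Require Import all_boot all_order all_algebra.

Set Implicit Arguments.
Unset Strict Implicit.
Unset Printing Implicit Defensive.

Definition is_partition (n : nat) (s : seq nat) : bool :=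
  [&& sorted geq s, all (leq 1) s & sumn s == n].

Record intpart (n : nat) :=
  IntPart { parts :> seq nat; partsP : is_partition n parts }.

HB.instance Definition _ n := [isSub for @parts n].
HB.instance Definition _ n := [Countable of intpart n by <:].

(* [intpart n] is finite: a partition of n has at most n parts, each at
   most n. *)
Section IntpartFinite.
Variable n : nat.

Lemma size_intpart (p : intpart n) : size p <= n.
Proof.
case: p => s /= /and3P[_ s_gt0 /eqP <-].
elim: s s_gt0 => //= x s IHs /andP[x_gt0 s_gt0].
by rewrite -add1n leq_add // IHs.
Qed.

Lemma leq_intpart (p : intpart n) i : i \in (p : seq nat) -> i <= n.
Proof.
case: p => s /= /and3P[_ _ /eqP <-].
elim: s => //= x s IHs; rewrite inE => /predU1P[-> | /IHs i_le].
  exact: leq_addr.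
exact: leq_trans i_le (leq_addl _ _).
Qed.

Definition intpart_bseq (p : intpart n) : n.-bseq 'I_n.+1 :=
  insub_bseq n [seq inord i | i <- p].

Definition bseq_intpart (b : n.-bseq 'I_n.+1) : option (intpart n) :=
  insub [seq val i | i <- b].

Lemma intpart_bseqK : pcancel intpart_bseq bseq_intpart.
Proof.
move=> p; rewrite /bseq_intpart /intpart_bseq /insub_bseq.
rewrite val_insubd size_map size_intpart -map_comp.
have -> : [seq (val \o @inord n) i | i <- p] = p :> seq nat.
  by apply: map_id_in => i /leq_intpart i_le; rewrite /= inordK.
exact: valK.
Qed.

HB.instance Definition _ := isFinite.Build (intpart n)
  (pcan_enumP intpart_bseqK).

End IntpartFinite.

Definition cong_pm (t r i : nat) : bool :=
  (i%:Z == t%:Z %[mod r%:Z])%Z || (i%:Z == - t%:Z %[mod r%:Z])%Z.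

(* pd_{+-t,r}(n) *)
Definition pd_pm (t r n : nat) : nat :=
  #|[set p : intpart n | uniq [seq i <- p | cong_pm t r i]]|.

(* p_{\overline{+-t},r}(n) *)
Definition p_avoid_pm (t r n : nat) : nat :=
  #|[set p : intpart n | all (fun i => ~~ cong_pm t r i) p]|.

(* Main.v *)
Require Import Defs.
From mathcomp Require Import all_boot all_order all_algebra.
From mathcomp Require Import zify.

(** Write A for the set of integers congruent to t or -t modulo r.  Since the
    integers congruent to 2t or -2t modulo 2r are exactly the doubles of
    elements of A ([cong_pm_double]), the theorem is the case of this A in a
    statement about an arbitrary set A of positive integers
    ([card_distinct_avoid_double]): partitions whose parts in A are distinct
    are equinumerous with partitions that have no part in 2A.  In terms of
    generating functions,
      prod_(i in A) (1 + q^i) * prod_(i notin A) 1 / (1 - q^i)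
        = prod_(i in A) (1 - q^(2i)) * prod_(i >= 1) 1 / (1 - q^i)
        = prod_(j notin 2A) 1 / (1 - q^j).

    The proof makes this identity bijective, by trading one factor at a time:
      1 / (1 - q^k) = (1 + q^k) * 1 / (1 - q^(2k))
    says that m copies of k can be exchanged for (m mod 2) copies of k and
    (m div 2) copies of 2k.  The elements k of A are treated in increasing
    order, so that when k is reached no constraint is left on the multiplicity
    of k (the condition that k be absent, if k is in 2A, was lifted when k/2
    was treated) and none has been put yet on that of 2k.  The family [stage]
    interpolates in this way between the two sets of partitions, and
    [card_stageS] is the exchange at k. *)

Set Implicit Arguments.
Unset Strict Implicit.
Unset Printing Implicit Defensive.

(** * Partitions and multiplicities *)

Lemma intpart_eq n (p q : intpart n) :
  (forall j, count_mem j p = count_mem j q) -> p = q.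
Proof.
move=> eq_pq; apply: val_inj.
have /and3P[p_sorted _ _] := partsP p; have /and3P[q_sorted _ _] := partsP q.
apply: (sorted_eq (leT := geq)) => //.
- by move=> y x z; rewrite /geq => le_yx le_zy; apply: leq_trans le_zy le_yx.
- by move=> x y; rewrite /geq andbC => /anti_leq.
- by rewrite /perm_eq; apply/allP=> x _; apply/eqP; apply: eq_pq.
Qed.

Lemma count_mem_intpart_gt n (p : intpart n) j : n < j -> count_mem j p = 0.
Proof.
move=> lt_nj; apply/count_memPn; apply: contraL lt_nj => /leq_intpart.
by rewrite -leqNgt.
Qed.

Lemma intpart_gt0 n (p : intpart n) j : j \in (p : seq nat) -> 0 < j.
Proof. by have /and3P[_ /allP p_gt0 _] := partsP p; apply: p_gt0. Qed.

(** * Exchanging copies of k and 2k *)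

Section Exchange.
Variables (n k : nat).
Implicit Type p : intpart n.

(** The number of copies of [k] in [p] once each [2k] is split as [k + k]. *)
Definition weight p := count_mem k p + (count_mem k.*2 p).*2.

(** [p] with [a] copies of [k] and [b] copies of [2k]; the default value [p]
    of [insubd] is never taken when [k > 0] and [a + 2b] is the weight of [p],
    because the sum is then preserved. *)
Definition exchange (a b : nat) p : intpart n :=
  insubd p (sort geq (nseq a k ++ nseq b k.*2 ++
                      [seq i <- p | (i != k) && (i != k.*2)])).

Hypothesis k_gt0 : 0 < k.

Lemma sumn_weight (s : seq nat) :
  sumn s = (count_mem k s + (count_mem k.*2 s).*2) * k
           + sumn [seq i <- s | (i != k) && (i != k.*2)].
Proof.
elim: s => //= x s ->.
have [->|neq_xk] := eqVneq x k.
  have -> : (k == k.*2) = false by apply/eqP; lia.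
  by rewrite /=; nia.
by have [->|_] := eqVneq x k.*2; rewrite /=; nia.
Qed.

Lemma count_exchange a b p : a + b.*2 = weight p ->
  forall j, count_mem j (exchange a b p) =
    if j == k then a else if j == k.*2 then b else count_mem j p.
Proof.
move=> eq_w j; rewrite /exchange val_insubd.
set u := nseq a k ++ _; case: ifPn => [_|/negP[]]; last first.
  have /and3P[_ /allP p_gt0 /eqP sum_p] := partsP p.
  apply/and3P; split.
  - by apply: sort_sorted => x y; apply: leq_total.
  - rewrite all_sort /u !all_cat !all_nseq double_gt0 k_gt0 !orbT /=.
    by apply/allP=> x; rewrite mem_filter => /andP[_ /p_gt0].
  have /perm_sumn-> : perm_eq (sort geq u) u by rewrite perm_sort.
  rewrite /u !sumn_cat !sumn_nseq -[X in _ == X]sum_p (sumn_weight p).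
  by rewrite -/(weight p) -eq_w; apply/eqP; nia.
have /permP-> : perm_eq (sort geq u) u by rewrite perm_sort.
rewrite /u !count_cat !count_nseq count_filter /=.
rewrite [k == j]eq_sym [_.*2 == j]eq_sym.
have [->|neq_jk] := eqVneq j k.
  have -> : (k == k.*2) = false by apply/eqP; lia.
  rewrite (eq_count (a2 := pred0)) ?count_pred0; first lia.
  by move=> i /=; case: eqP.
have [->|neq_j2k] := eqVneq j k.*2.
  rewrite (eq_count (a2 := pred0)) ?count_pred0; first lia.
  by move=> i /=; have [->|//] := eqVneq i k.*2; rewrite andbF.
rewrite !mul0n; apply: eq_count => i /=.
by have [->|//] := eqVneq i j; rewrite neq_jk neq_j2k.
Qed.

Lemma weight_exchange a b p :
  a + b.*2 = weight p -> weight (exchange a b p) = weight p.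
Proof.
move=> eq_w; rewrite {1}/weight !(count_exchange eq_w) !eqxx.
by have /negbTE-> : k.*2 != k by apply/eqP; lia.
Qed.

(** Exchanges compose, hence are undone by putting the multiplicities back. *)
Lemma exchangeK a b a' b' p : a + b.*2 = weight p ->
  count_mem k p = a' -> count_mem k.*2 p = b' ->
  exchange a' b' (exchange a b p) = p.
Proof.
move=> eq_w eq_a eq_b; apply: intpart_eq => j.
rewrite count_exchange; last by rewrite weight_exchange // -eq_a -eq_b.
rewrite (count_exchange eq_w).
by case: (j =P k) => [->//|_]; case: (j =P k.*2) => [->|].
Qed.

End Exchange.

(** * Trading the elements of A one at a time *)

Lemma card_in_bij (T T' : finType) (f : T -> T') (g : T' -> T)
    (X : {set T}) (Y : {set T'}) :
  {in X, forall x, f x \in Y} -> {in Y, forall y, g y \in X} ->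
  {in X, cancel f g} -> {in Y, cancel g f} -> #|X| = #|Y|.
Proof.
move=> fY gX fK gK; rewrite -(card_in_imset (can_in_inj fK)).
congr #|pred_of_set _|; apply/setP=> y.
apply/imsetP/idP => [[x /fY fxY ->]//|yY].
by exists (g y); rewrite ?gX ?gK.
Qed.

Section Interpolation.
Variables (n : nat) (A : pred nat).

(** The partitions of [n] once the elements of A below [k] have been treated.
    Only indices in [1, n] matter, as other integers are not parts. *)
Definition stage (k : nat) : {set intpart n} :=
  [set p : intpart n | all (fun i => A i ==>
     (if i < k then count_mem i p <= 1 else count_mem i.*2 p == 0)) (iota 1 n)].

Lemma stageP k (p : intpart n) :
  reflect (forall i, 0 < i -> A i ->
             if i < k then count_mem i p <= 1 else count_mem i.*2 p == 0)
          (p \in stage k).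
Proof.
rewrite inE; apply: (iffP allP) => [p_ok i i_gt0 Ai | p_ok i]; last first.
  by rewrite mem_iota => /andP[i_gt0 _]; apply/implyP; apply: p_ok.
have [le_in|lt_ni] := leqP i n.
  by apply: (implyP (p_ok i _)) => //; rewrite mem_iota i_gt0 add1n ltnS.
by rewrite !count_mem_intpart_gt //; [case: ifP | lia].
Qed.

(** The exchange at [k] disturbs no constraint at an index [i <> k]: for
    [i < k] the constraint is on [i], for [i > k] it is on [2i], and neither of
    these is [k] or [2k].  At [k] itself, [stage k] has no part [2k] and any
    number of parts [k], and [stage k.+1] has at most one part [k] and any
    number of parts [2k]; a given weight is then realised exactly once on each
    side, by division by 2. *)
Lemma card_stageS k : 0 < k -> #|stage k| = #|stage k.+1|.
Proof.
move=> k_gt0; case Ak: (A k); last first.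
  apply: eq_card => p; rewrite !inE; apply: eq_all => i.
  rewrite ltnS (leq_eqVlt i k); have [->|//] := eqVneq i k.
  by rewrite Ak.
pose f (p : intpart n) :=
  exchange k (weight k p %% 2) (weight k p %/ 2) p.
pose g (p : intpart n) := exchange k (weight k p) 0 p.
have wf q : @weight n k q %% 2 + (weight k q %/ 2).*2 = weight k q.
  by lia.
have wg q : @weight n k q + 0.*2 = weight k q by rewrite addn0.
apply: (@card_in_bij _ _ f g) => p /stageP p_ok.
- apply/stageP=> i i_gt0 Ai; rewrite !(count_exchange k_gt0 (wf p)).
  have := p_ok i i_gt0 Ai; rewrite ltnS.
  case: (ltngtP i k) => [lt_ik|lt_ki|->] //.
  + by have /negbTE-> : i != k.*2 by lia.
  + have /negbTE-> : i.*2 != k by lia.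
    by have /negbTE-> : i.*2 != k.*2 by lia.
  + by move=> _; lia.
- apply/stageP=> i i_gt0 Ai; rewrite !(count_exchange k_gt0 (wg p)).
  have := p_ok i i_gt0 Ai; rewrite ltnS.
  case: (ltngtP i k) => [lt_ik|lt_ki|->] //.
  + by have /negbTE-> : i != k.*2 by lia.
  + have /negbTE-> : i.*2 != k by lia.
    by have /negbTE-> : i.*2 != k.*2 by lia.
  + have /negbTE-> : k.*2 != k by lia.
    by rewrite eqxx.
- have := p_ok k k_gt0 Ak; rewrite ltnn => /eqP p2k.
  rewrite /g weight_exchange // /f; apply: exchangeK => //.
  by rewrite /weight p2k addn0.
- have := p_ok k k_gt0 Ak; rewrite ltnSn => pk.
  rewrite /f weight_exchange // /g; apply: exchangeK => //.
  + by rewrite /weight; lia.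
  + by rewrite /weight; lia.
Qed.

Lemma stage_avoid :
  stage 1 = [set p : intpart n | all (fun j => ~~ (~~ odd j && A j./2)) p].
Proof.
apply/setP=> p; rewrite [RHS]inE.
apply/stageP/allP => [p_ok j jp | p_ok i i_gt0 Ai].
  apply/negP=> /andP[even_j Aj]; have j_gt0 := intpart_gt0 jp.
  have j2_gt0 : 0 < j./2 by lia.
  have := p_ok _ j2_gt0 Aj; rewrite ltnNge j2_gt0 /=.
  by rewrite even_halfK // => /eqP/count_memPn; rewrite jp.
rewrite ltnNge i_gt0; apply/eqP/count_memPn/negP => /p_ok.
by rewrite odd_double doubleK Ai.
Qed.

Lemma stage_distinct :
  stage n.+1 = [set p : intpart n | uniq [seq i <- p | A i]].
Proof.
apply/setP=> p; rewrite [RHS]inE.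
apply/stageP/idP => [p_ok | uniq_p i i_gt0 Ai].
  apply: count_mem_uniq => x; rewrite count_filter mem_filter.
  case Ax: (A x); last first.
    rewrite (eq_count (a2 := pred0)) ?count_pred0 // => y /=.
    by case: eqP => // ->; rewrite Ax.
  rewrite (eq_count (a2 := pred1 x)) => [|y /=]; last by case: eqP => // ->.
  have [xp|/count_memPn-> //] := boolP (x \in (p : seq nat)).
  (* A part x occurs at least once, and at most once by [p_ok]. *)
  have := p_ok x (intpart_gt0 xp) Ax; rewrite ltnS (leq_intpart xp).
  by move: xp; rewrite -has_pred1 has_count /=; case: (count _ _) => [|[]].
case: ifP => [_|/negbT]; last first.
  by rewrite -leqNgt => lt_ni; rewrite count_mem_intpart_gt //; lia.
suff -> : count_mem i p = count_mem i [seq j <- p | A j].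
  by rewrite count_uniq_mem // leq_b1.
by rewrite count_filter; apply: eq_count => j /=; case: eqP => // ->.
Qed.

Theorem card_distinct_avoid_double :
  #|[set p : intpart n | uniq [seq i <- p | A i]]|
  = #|[set p : intpart n | all (fun j => ~~ (~~ odd j && A j./2)) p]|.
Proof.
rewrite -stage_avoid -stage_distinct.
have eq_stage m : #|stage m.+1| = #|stage 1|.
  by elim: m => // m <-; rewrite -card_stageS.
exact: eq_stage.
Qed.

End Interpolation.

(** * Congruence classes *)

(** An odd j cannot be congruent to 2t or -2t modulo the even number 2r, and
    for even j the factor 2 cancels. *)
Lemma cong_pm_double t r j :
  cong_pm (2 * t) (2 * r) j = ~~ odd j && cong_pm t r j./2.
Proof.
rewrite /cong_pm !eqz_mod_dvd !GRing.opprK.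
have [odd_j|even_j] := boolP (odd j).
  apply/negP=> /orP[] /dvdzP[q]; lia.
have -> : Posz j = (Posz 2 * Posz j./2)%R by lia.
rewrite !PoszM -GRing.mulrBr -GRing.mulrDr.
by rewrite !dvdz_mul2l.
Qed.

Theorem theorem1p1 (n r t : nat) (r_ge2 : 2 <= r) (t_gt0 : 0 < t)
    (t_lt : 2 * t < r) :
  pd_pm t r n = p_avoid_pm (2 * t) (2 * r) n.
Proof.
rewrite /pd_pm card_distinct_avoid_double; apply: eq_card => p.
by rewrite !inE; apply: eq_all => j; rewrite cong_pm_double.
Qed.
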